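(* Let the system, constraints, cost, horizon $N\ge 1$ and functions $\rho$, $V_f$, $\lambda$ be as in the context, and suppose: (A1) the parameter set $\Theta$ is compact; (A2) the storage function $\lambda(\theta,x)$ is continuous on $\Theta\times\mathbb{X}$; (A3) the system is strictly controlled dissipative with respect to the supply rate $s(x,u)=\ell(x,u)-\ell(x^s,u^s)$: for all $\theta\in\Theta$ and all $x\in\mathbb{X}$ there exist $\theta^+\in\Theta$ and $u\in\mathbb{U}$ with $(x,u)\in\mathbb{Z}$ such that $$\lambda(\theta^+,f(x,u))-\lambda(\theta,x)\le\ell(x,u)-\ell(x^s,u^s)-\rho(x-x^s);$$ (A4) there exist a compact terminal region $\mathbb{X}_f\subseteq\mathbb{X}$ with $x^s$ as an interior point, a terminal policy $\kappa_f:\mathbb{X}\to\mathbb{U}$ with $\kappa_f(x^s)=u^s$, and a continuous terminal penalty $V_f:\mathbb{X}_f\to\mathbb{R}$ (these $\mathbb{X}_f$ and $V_f$ are the ones used in the optimisation problem), such that for all $x\in\mathbb{X}_f$: (i) $(x,\kappa_f(x))\in\mathbb{Z}$; (ii) $f(x,\kappa_f(x))\in\mathbb{X}_f$; (iii) $V_f(f(x,\kappa_f(x)))-V_f(x)\le\ell(x^s,u^s)-\ell(x,\kappa_f(x))$; (A5) for all $x\in\mathbb{X}_f$ and all $\theta\in\Theta$ there exists $\theta^+\in\Theta$ such that $$\lambda(\theta^+,f(x,\kappa_f(x)))-\lambda(\theta,x)\le \ell(x,\kappa_f(x))-\ell(x^s,u^s)-\rho(x-x^s);$$ (A6) $\lambda(\theta,x^s)=0$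 for all $\theta\in\Theta$. Then, under the EMPC controller, the optimal steady state $x^s$ (with input $u^s$) is asymptotically stable for the closed loop with region of attraction $\mathcal{X}_N$. That is: for every $\varepsilon>0$ there is $\delta>0$ such that every closed-loop solution with $(x_0,\theta_0)\in\mathcal{X}_N$ and $\|x_0-x^s\|<\delta$ satisfies $\|x_t-x^s\|<\varepsilon$ for all $t\ge0$; and every closed-loop solution with $(x_0,\theta_0)\in\mathcal{X}_N$ satisfies $\lim_{t\to\infty}x_t=x^s$.
   Context: System: $x_{t+1}=f(x_t,u_t)$ with state $x\in\mathbb{X}\subseteq\mathbb{R}^n$, input $u\in\mathbb{U}\subseteq\mathbb{R}^m$, and continuous $f:\mathbb{X}\times\mathbb{U}\to\mathbb{X}$. Constraints: $(x_t,u_t)\in\mathbb{Z}$ for all $t\ge0$, where $\mathbb{Z}\subseteq\mathbb{X}\times\mathbb{U}$ is compact. The stage cost $\ell:\mathbb{Z}\to\mathbb{R}$ is continuous. The optimal steady state is $(x^s,u^s)=\arg\min\{\ell(x,u)\mid (x,u)\in\mathbb{Z},\ x=f(x,u)\}$, assumed to exist and be unique. $\|\cdot\|$ is the Euclidean norm. $\Theta$ is a set of (finite-dimensional real) parameters and $\lambda:\Theta\times\mathbb{X}\to\mathbb{R}$ is a parameter-varying storage function. $\rho:\mathbb{R}^n\to\mathbb{R}_{\ge0}$ is a fixed positive definite function: continuous, $\rho(0)=0$, $\rho(z)>0$ for $z\ne0$. EMPC optimisation problem $\mathcal{P}_N(x_t,\theta_t)$ at time $t$, with horizon $N\in\mathbb{Z}_{\ge1}$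 (here $\mathbb{Z}_{\geq 1}$ denotes the positive integers): minimise $$J_N=\sum_{k=t}^{t+N-1}\ell(x_{k|t},u_{k|t})+V_f(x_{t+N|t})$$ over sequences $(\theta_{k|t})_{k=t}^{t+N}$, $(x_{k|t})_{k=t}^{t+N}$, $(u_{k|t})_{k=t}^{t+N-1}$ subject to: $x_{t|t}=x_t$; $\theta_{t|t}=\theta_t$; for all $k=t,\dots,t+N-1$: $x_{k+1|t}=f(x_{k|t},u_{k|t})$, $(x_{k|t},u_{k|t})\in\mathbb{Z}$, and $$\lambda(\theta_{k+1|t},x_{k+1|t})-\lambda(\theta_{k|t},x_{k|t})+\rho(x_{k|t}-x^s)\le\ell(x_{k|t},u_{k|t})-\ell(x^s,u^s);$$ $\theta_{k|t}\in\Theta$ for $k=t,\dots,t+N$; and $x_{t+N|t}\in\mathbb{X}_f$. $\mathcal{X}_N$ is the set of $(x,\theta)\in\mathbb{X}\times\Theta$ for which $\mathcal{P}_N(x,\theta)$ has a feasible solution. Closed loop: at each time $t$ an optimal solution (marked by $*$) of $\mathcal{P}_N(x_t,\theta_t)$ is computed, and $x_{t+1}=f(x_t,u^*_{t|t})$, $\theta_{t+1}=\theta^*_{t+1|t}$. *)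

(* Defs.v *)
From mathcomp Require Import all_boot all_order all_algebra.
From mathcomp Require Import all_classical all_reals all_analysis.

Set Implicit Arguments.
Unset Strict Implicit.
Unset Printing Implicit Defensive.

Import Order.TTheory GRing.Theory Num.Theory.
Import numFieldNormedType.Exports.

Local Open Scope classical_set_scope.
Local Open Scope ring_scope.

(* The library norm on 'rV[R]_n is the sup norm, hence this definition.  The
   library (product) topology on 'rV[R]_n is the Euclidean one. *)
Definition eucl_norm (R : realType) (n : nat) (x : 'rV[R]_n) : R :=
  Num.sqrt (\sum_(i < n) x 0 i ^+ 2).

(* Functions given only on a subset (dynamics, stage_cost, storage,
   terminal_cost) are total here; their values outside that subset are
   arbitrary, and continuity is always required within the subset only. *)
Record empc (R : realType) (n m p : nat) := Empc {
  state_set : set 'rV[R]_n;                     (* X *)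
  input_set : set 'rV[R]_m;                     (* U *)
  constraint_set : set ('rV[R]_n * 'rV[R]_m);   (* Z *)
  dynamics : 'rV[R]_n * 'rV[R]_m -> 'rV[R]_n;   (* f *)
  stage_cost : 'rV[R]_n * 'rV[R]_m -> R;        (* ell *)
  xs : 'rV[R]_n;
  us : 'rV[R]_m;
  param_set : set 'rV[R]_p;                     (* Theta *)
  storage : 'rV[R]_p * 'rV[R]_n -> R;           (* lambda *)
  rho : 'rV[R]_n -> R;
  horizon : nat;                                (* N *)
  terminal_set : set 'rV[R]_n;                  (* X_f *)
  terminal_cost : 'rV[R]_n -> R                 (* V_f *)
}.

Section Defs.
Context (R : realType) (n m p : nat).
Implicit Types (P : empc R n m p) (x : 'rV[R]_n) (theta : 'rV[R]_p).

Definition steady_states P : set ('rV[R]_n * 'rV[R]_m) :=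
  [set z | constraint_set P z /\ z.1 = dynamics P z].

Definition optimal_steady_states P : set ('rV[R]_n * 'rV[R]_m) :=
  [set z | steady_states P z /\
     forall w, steady_states P w -> stage_cost P z <= stage_cost P w].

(* The problem is time invariant, so predictions are indexed relatively to the
   current time t: [xx k] stands for x_{t+k|t}, and likewise for [th] and [uu].
   Only th_0, ..., th_N, xx_0, ..., xx_N and uu_0, ..., uu_(N-1) are decision
   variables; later entries occur in neither constraints nor cost. *)
Definition feasible P x theta (th : nat -> 'rV[R]_p) (xx : nat -> 'rV[R]_n)
    (uu : nat -> 'rV[R]_m) : Prop :=
  [/\ xx 0%N = x,
      th 0%N = theta,
      forall k, (k < horizon P)%N ->
        [/\ xx k.+1 = dynamics P (xx k, uu k),
            constraint_set P (xx k, uu k) &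
            storage P (th k.+1, xx k.+1) - storage P (th k, xx k)
              + rho P (xx k - xs P)
            <= stage_cost P (xx k, uu k) - stage_cost P (xs P, us P)],
      forall k, (k <= horizon P)%N -> param_set P (th k) &
      terminal_set P (xx (horizon P))].

Definition total_cost P (xx : nat -> 'rV[R]_n) (uu : nat -> 'rV[R]_m) : R :=
  \sum_(0 <= k < horizon P) stage_cost P (xx k, uu k)
    + terminal_cost P (xx (horizon P)).

Definition optimal P x theta (th : nat -> 'rV[R]_p) (xx : nat -> 'rV[R]_n)
    (uu : nat -> 'rV[R]_m) : Prop :=
  feasible P x theta th xx uu /\
  forall th' xx' uu', feasible P x theta th' xx' uu' ->
    total_cost P xx uu <= total_cost P xx' uu'.

Definition feasible_set P : set ('rV[R]_n * 'rV[R]_p) :=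
  [set z | [/\ state_set P z.1, param_set P z.2 &
     exists th xx uu, feasible P z.1 z.2 th xx uu]].

(* Optimal solutions need not be unique: any of them may be applied at each
   time. *)
Definition closed_loop P (x : nat -> 'rV[R]_n) (theta : nat -> 'rV[R]_p)
    : Prop :=
  forall t, exists th xx uu,
    [/\ optimal P (x t) (theta t) th xx uu,
        x t.+1 = dynamics P (x t, uu 0%N) &
        theta t.+1 = th 1%N].

End Defs.

(* Main.v *)
Require Import Defs.
From mathcomp Require Import all_boot all_order all_algebra.
From mathcomp Require Import all_classical all_reals all_analysis.
From mathcomp Require Import lra.

Set Implicit Arguments.
Unset Strict Implicit.
Unset Printing Implicit Defensive.

Import Order.TTheory GRing.Theory Num.Theory.
Import numFieldNormedType.Exports.

Local Open Scope classical_set_scope.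
Local Open Scope ring_scope.

(* The rotated optimal value W = J* - N ell(x^s,u^s) + lambda - V_f(x^s) is a
   Lyapunov function along the closed loop.  Telescoping the dissipation
   constraints gives W >= rho(x - x^s) as soon as the rotated terminal cost
   V_f + lambda - V_f(x^s) is nonnegative on Theta x X_f; it is, because it
   attains its minimum there, vanishes at x = x^s, and strictly decreases along
   the terminal policy elsewhere.  Appending the terminal policy to the shifted
   prediction gives W(t+1) <= W(t) - rho(x_t - x^s), and running the terminal
   policy from the start bounds W by the rotated terminal cost on X_f, which is
   small near x^s uniformly in theta because Theta is compact. *)

(** * Euclidean norm and the topology of row vectors *)

Lemma eucl_norm0 (R : realType) (n : nat) : eucl_norm (0 : 'rV[R]_n) = 0.
Proof.
by rewrite /eucl_norm big1 ?sqrtr0// => i _; rewrite mxE expr0n.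
Qed.

Lemma mx_norm_le_eucl_norm (R : realType) (n : nat) (x : 'rV[R]_n) :
  `|x| <= eucl_norm x.
Proof.
rewrite [`|x|]mx_normrE; apply: bigmax_le => [|[i j] _ /=].
  exact: sqrtr_ge0.
rewrite ord1 -sqrtr_sqr ler_wsqrtr// (bigD1 j)//= lerDl.
by apply: sumr_ge0 => k _; exact: sqr_ge0.
Qed.

Lemma eucl_norm_continuous (R : realType) (n : nat) :
  continuous (@eucl_norm R n).
Proof.
move=> x; apply: continuous_comp; last exact: sqrt_continuous.
apply: (@continuous_big _ _ _ _ _ _ _ _ (fun i (y : 'rV[R]_n) => y 0 i ^+ 2)).
  exact: add_continuous.
move=> i _ y; apply: (@continuous_comp _ _ _ (fun y : 'rV[R]_n => y 0 i)
  (fun z : R => z ^+ 2)).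
  exact: coord_continuous.
exact: exprn_continuous.
Qed.

Lemma nbhs_eucl_norm_lt (R : realType) (n : nat) (x : 'rV[R]_n) (eps : R) :
  0 < eps -> \forall y \near x, eucl_norm (y - x) < eps.
Proof.
move=> eps_gt0.
have : eucl_norm (y - x) @[y --> x] --> eucl_norm (x - x).
  apply: (@continuous_comp _ _ _ (fun y : 'rV[R]_n => y - x) _ x).
    by apply: continuousB => //; exact: cst_continuous.
  exact: eucl_norm_continuous.
by rewrite subrr eucl_norm0 => /cvgr_lt; exact.
Qed.

Lemma nbhs_eucl_norm_ball (R : realType) (n : nat) (x : 'rV[R]_n)
    (A : set 'rV[R]_n) :
  nbhs x A -> exists2 delta : R, 0 < delta &
    forall y, eucl_norm (y - x) < delta -> A y.
Proof.
move=> /nbhs_ballP[delta /= delta_gt0 ballA]; exists delta => // y yx.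
apply: ballA; rewrite -ball_normE/= distrC.
exact: le_lt_trans (mx_norm_le_eucl_norm _) yx.
Qed.

(** * Compactness and convergence tools *)

(** The minimum of [r] over the part of [K] outside the interior of [A] is positive and serves as
    [delta]. This replaces a comparison-function lower bound on [r]. *)
Lemma compact_small_value_nbhs (R : realType) (T : topologicalType)
    (K A : set T) (r : T -> R) (x : T) :
  compact K -> continuous r -> (forall y, y <> x -> 0 < r y) -> nbhs x A ->
  exists2 delta : R, 0 < delta & forall y, K y -> r y < delta -> A y.
Proof.
move=> K_compact r_cont r_pos xA.
set C := K `&` ~` A°.
have C_compact : compact C.
  by apply: compact_closedI => //; apply: open_closedC; exact: open_interior.
have [[z Cz]|C0] := pselect (C !=set0); last first.
  (* Here [K] lies inside [A], so any positive [delta] would do. *)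
  exists 1 => // y Ky _; apply: contrapT => nAy; apply: C0; exists y.
  by split=> // /interior_subset.
have [||c] := @compact_EVT_min T R r C _ C_compact; first by exists z.
  exact: continuous_subspaceT.
rewrite inE => -[_ cA] c_min; exists (r c).
  by apply: r_pos => cx; apply: cA; rewrite cx.
move=> y Ky; apply: contraPP => nAy; apply/negP; rewrite -leNgt; apply: c_min.
by rewrite inE; split=> // /interior_subset.
Qed.

(** A negative minimum could be improved, contradicting minimality. *)
Lemma compact_ge0_of_improvable (R : realType) (T : topologicalType)
    (K : set T) (V : T -> R) :
  compact K -> {within K, continuous V} ->
  (forall z, K z -> V z < 0 -> exists2 z', K z' & V z' < V z) ->
  forall z, K z -> 0 <= V z.
Proof.
move=> K_compact V_cont V_improv z Kz.
have [|c] := @compact_EVT_min T R V K _ K_compact V_cont; first by exists z.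
rewrite inE => Kc c_min.
apply: (@le_trans _ _ (V c)); last by apply: c_min; rewrite inE.
rewrite leNgt; apply/negP => /(V_improv _ Kc)[z' Kz'].
by rewrite ltNge c_min// inE.
Qed.

(** Tube lemma: joint continuity gives the bound near each [(theta, x)], and compactness of [K]
    yields one neighbourhood of [x] valid for all [theta]. *)
Lemma near_within_compact_small (R : realType) (T1 T2 : topologicalType)
    (K : set T1) (X : set T2) (g : T1 * T2 -> R) (x : T2) (eps : R) :
  compact K -> X x -> {within K `*` X, continuous g} ->
  (forall theta, K theta -> g (theta, x) = 0) -> 0 < eps ->
  \forall y \near x, X y -> forall theta, K theta -> g (theta, y) < eps.
Proof.
move=> K_compact Xx g_cont g0 eps_gt0.
have /near_covering_withinP := (compact_near_coveringP K).1 K_compact.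
move=> /(_ _ (nbhs x) (fun y theta => X y -> g (theta, y) < eps)) cover.
have : \forall y \near x, K `<=` [set theta | X y -> g (theta, y) < eps].
  apply: cover => theta Ktheta.
  have : g @ within (K `*` X) (nbhs (theta, x)) --> 0.
    rewrite -(g0 _ Ktheta); move/subspace_continuousP : g_cont.
    by apply; split.
  move=> /cvgr_lt/(_ _ eps_gt0); rewrite near_withinE.
  by apply: filterS => -[theta' y] /= + Ktheta' Xy; apply.
by apply: filterS => y Ky Xy theta Ktheta; exact: Ky.
Qed.

(** [W] is nonincreasing and bounded below, hence convergent, and [r t] is squeezed between 0 and
    [W t - W t.+1]. *)
Lemma cvg0_of_telescoping (R : realType) (W r : nat -> R) :
  (forall t, 0 <= W t) -> (forall t, 0 <= r t) ->
  (forall t, W t.+1 <= W t - r t) -> r t @[t --> \oo] --> 0.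
Proof.
move=> W_ge0 r_ge0 W_descent.
have W_cvg : cvgn W.
  apply: nonincreasing_is_cvgn; last by exists 0 => _ [t _ <-].
  apply/nonincreasing_seqP => t.
  by rewrite (le_trans (W_descent t))// gerBl.
apply: (@squeeze_cvgr _ _ _ _ (fun=> 0) (fun t => W t - W t.+1)).
- by apply: nearW => t; rewrite r_ge0/= lerBrDl -lerBrDr.
- exact: cvg_cst.
rewrite -(subrr (limn W)); apply: cvgB => //.
by rewrite (cvg_shiftS W).
Qed.

(** * Rotated costs and the lower bound on the Lyapunov function *)

(* [lyapunov P x theta] is J* - N ell(x^s,u^s) + lambda(theta, x) - V_f(x^s)
   when [xx] and [uu] are optimal. *)
Definition lyapunov (R : realType) (n m p : nat) (P : empc R n m p)
    (x : 'rV[R]_n) (theta : 'rV[R]_p) (xx : nat -> 'rV[R]_n)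
    (uu : nat -> 'rV[R]_m) : R :=
  total_cost P xx uu - (horizon P)%:R * stage_cost P (xs P, us P)
    + storage P (theta, x) - terminal_cost P (xs P).

Definition rotated_terminal_cost (R : realType) (n m p : nat)
    (P : empc R n m p) (z : 'rV[R]_p * 'rV[R]_n) : R :=
  terminal_cost P z.2 + storage P z - terminal_cost P (xs P).

Lemma rho_le_lyapunov (R : realType) (n m p : nat) (P : empc R n m p) x theta
    th xx uu :
  (1 <= horizon P)%N -> (forall z, 0 <= rho P z) ->
  feasible P x theta th xx uu ->
  rho P (x - xs P) + rotated_terminal_cost P (th (horizon P), xx (horizon P))
    <= lyapunov P x theta xx uu.
Proof.
move=> N_ge1 rho_ge0 [xx0 th0 step _ _].
(* Summing the constraints for k = 0, ..., j telescopes the storage; only the first [rho] term is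
   kept, the later ones being nonnegative. The last step, j = N - 1, gives the claim. *)
suff /(_ (horizon P).-1) : forall j, (j < horizon P)%N ->
    rho P (x - xs P) + storage P (th j.+1, xx j.+1) <=
    \sum_(0 <= k < j.+1) stage_cost P (xx k, uu k)
      - j.+1%:R * stage_cost P (xs P, us P) + storage P (theta, x).
  rewrite prednK// leqnn => /(_ isT).
  by rewrite /lyapunov /total_cost /rotated_terminal_cost/=; lra.
elim=> [|j IHj] jN; have [_ _] := step _ jN.
  by rewrite big_nat1 xx0 th0; lra.
rewrite big_nat_recr//= -[j.+2%:R]natr1 mulrDl mul1r.
by have := IHj (ltnW jN); have := rho_ge0 (xx j.+1 - xs P); lra.
Qed.

(** This and the next definition unfold to hypotheses of the theorem, which can thus be passed to
    the lemmas as they stand. *)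
Definition terminal_controller (R : realType) (n m p : nat) (P : empc R n m p)
    (kappaf : 'rV[R]_n -> 'rV[R]_m) : Prop :=
  forall x, terminal_set P x ->
    [/\ constraint_set P (x, kappaf x),
        terminal_set P (dynamics P (x, kappaf x)) &
        terminal_cost P (dynamics P (x, kappaf x)) - terminal_cost P x
        <= stage_cost P (xs P, us P) - stage_cost P (x, kappaf x)].

Definition terminally_dissipative (R : realType) (n m p : nat)
    (P : empc R n m p) (kappaf : 'rV[R]_n -> 'rV[R]_m) : Prop :=
  forall x theta, terminal_set P x -> param_set P theta ->
    exists2 theta', param_set P theta' &
      storage P (theta', dynamics P (x, kappaf x)) - storage P (theta, x)
      <= stage_cost P (x, kappaf x) - stage_cost P (xs P, us P)
         - rho P (x - xs P).

(** * Feasible candidates built from the terminal policy *)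

(** Shifting drops the first stage cost; the appended terminal step changes the cost by at most
    [stage_cost P (xs P, us P)], by the decrease of the terminal cost. *)
Lemma shifted_candidate (R : realType) (n m p : nat) (P : empc R n m p) kappaf
    x theta th xx uu :
  terminal_controller P kappaf -> terminally_dissipative P kappaf ->
  (1 <= horizon P)%N -> feasible P x theta th xx uu ->
  exists th' xx' uu',
    feasible P (dynamics P (x, uu 0%N)) (th 1%N) th' xx' uu' /\
    total_cost P xx' uu'
      <= total_cost P xx uu - stage_cost P (x, uu 0%N)
         + stage_cost P (xs P, us P).
Proof.
move=> control dissip; case NE: (horizon P) => [//|N] _ [xx0 th0 step thP xN].
rewrite NE in step thP xN.
have [ZN XN VN] := control _ xN.
have [theta' thetaP' dissN] := dissip _ _ xN (thP _ (leqnn _)).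
(* The horizon is now [N.+1]: states and parameters are shifted up to index [N] and get a new entry
   at [N.+1], while the new input already sits at index [N]. *)
pose th' k := if (k <= N)%N then th k.+1 else theta'.
pose xx' k :=
  if (k <= N)%N then xx k.+1 else dynamics P (xx N.+1, kappaf (xx N.+1)).
pose uu' k := if (k < N)%N then uu k.+1 else kappaf (xx N.+1).
exists th', xx', uu'; split; first split.
- by rewrite /xx' /=; have [-> _ _] := step 0%N isT; rewrite xx0.
- by [].
- move=> k; rewrite NE ltnS /th' /xx' /uu' => kN; rewrite kN.
  have [kltN|kgeN] := ltnP k N; first exact: step.
  have -> : k = N by apply/eqP; rewrite eqn_leq kN.
  by split=> //; move: dissN; lra.
- move=> k; rewrite NE /th'; have [kN _|//] := leqP k N.
  exact: thP.
- by rewrite NE /xx' ltnn.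
rewrite /total_cost NE /xx' ltnn big_nat_recr//= leqnn /uu' ltnn.
rewrite [X in X + _ + _ <= _](_ : _ =
    \sum_(0 <= k < N) stage_cost P (xx k.+1, uu k.+1)).
    by rewrite [in leRHS]big_nat_recl//= xx0; move: VN; lra.
by apply: eq_big_nat => k /andP[_ kN]; rewrite kN (ltnW kN).
Qed.

(** The terminal policy is followed from the start, with parameters chosen by terminal
    dissipativity; the decrease of the terminal cost is then summed over the horizon. *)
Lemma terminal_candidate (R : realType) (n m p : nat) (P : empc R n m p) kappaf
    x theta :
  terminal_controller P kappaf -> terminally_dissipative P kappaf ->
  terminal_set P x -> param_set P theta ->
  exists th xx uu, feasible P x theta th xx uu /\
    total_cost P xx uu
      <= (horizon P)%:R * stage_cost P (xs P, us P) + terminal_cost P x.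
Proof.
move=> control dissip Xfx Thetatheta.
have /choice[next nextP] : forall z : 'rV[R]_n * 'rV[R]_p, exists theta',
    terminal_set P z.1 -> param_set P z.2 -> param_set P theta' /\
    storage P (theta', dynamics P (z.1, kappaf z.1)) - storage P (z.2, z.1)
      <= stage_cost P (z.1, kappaf z.1) - stage_cost P (xs P, us P)
         - rho P (z.1 - xs P).
  move=> z.
  have [[Xfz Tz]|nz] := pselect (terminal_set P z.1 /\ param_set P z.2).
    by have [theta' ? ?] := dissip _ _ Xfz Tz; exists theta'.
  (* Off the terminal set or the parameter set, 0 is an arbitrary value that makes [next] total. *)
  by exists 0 => ? ?; exfalso; exact: nz.
(* State and parameter are iterated jointly, since [next] depends on both. *)
pose traj := fix traj k := if k is j.+1
  then (dynamics P ((traj j).1, kappaf (traj j).1), next (traj j))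
  else (x, theta).
have trajP k : terminal_set P (traj k).1 /\ param_set P (traj k).2.
  elim: k => [//|k [Xk Tk]] /=.
  by have [_ ? _] := control _ Xk; have [? _] := nextP _ Xk Tk.
exists (fun k => (traj k).2), (fun k => (traj k).1),
  (fun k => kappaf (traj k).1); split; first split=> //.
- move=> k _; have [Xk Tk] := trajP k.
  have [Zk _ _] := control _ Xk; have [_ dk] := nextP _ Xk Tk.
  by split=> //=; move: dk; lra.
- by move=> k _; have [] := trajP k.
- by have [] := trajP (horizon P).
rewrite /total_cost; elim: (horizon P) => [|j IHj].
  by rewrite big_geq// mul0r.
rewrite big_nat_recr//= -natr1 mulrDl mul1r.
by have [_ _] := control _ (trajP j).1; move: IHj; lra.
Qed.

(** * Lyapunov descent along the closed loop, and stability *)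

Lemma closed_loop_lyapunov (R : realType) (n m p : nat) (P : empc R n m p)
    kappaf x theta :
  terminal_controller P kappaf -> terminally_dissipative P kappaf ->
  (1 <= horizon P)%N -> (forall z, 0 <= rho P z) ->
  (forall z, param_set P z.1 -> terminal_set P z.2 ->
     0 <= rotated_terminal_cost P z) ->
  closed_loop P x theta ->
  exists W : nat -> R,
    [/\ forall t, rho P (x t - xs P) <= W t,
        forall t, W t.+1 <= W t - rho P (x t - xs P) &
        terminal_set P (x 0%N) ->
          W 0%N <= rotated_terminal_cost P (theta 0%N, x 0%N)].
Proof.
move=> control dissip N_ge1 rho_ge0 Vf_ge0 loop.
(* [W t] is evaluated at an optimal prediction that also generates the step to t + 1. *)
have /choice[W WP] : forall t, exists w, exists th xx uu,
    [/\ optimal P (x t) (theta t) th xx uu,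
        x t.+1 = dynamics P (x t, uu 0%N), theta t.+1 = th 1%N &
        w = lyapunov P (x t) (theta t) xx uu].
  move=> t; have [th [xx [uu [opt xS thetaS]]]] := loop t.
  by exists (lyapunov P (x t) (theta t) xx uu), th, xx, uu.
exists W; split=> [t|t|Xfx0].
- have [th [xx [uu [[feas _] _ _ ->]]]] := WP t.
  apply: le_trans (rho_le_lyapunov N_ge1 rho_ge0 feas); rewrite lerDl.
  by have [_ _ _ thP xN] := feas; apply: Vf_ge0 => //=; exact: thP.
- have [th [xx [uu [[feas _] xS thetaS ->]]]] := WP t.
  have [th1 [xx1 [uu1 [[_ opt1] _ _ ->]]]] := WP t.+1.
  have [th' [xx' [uu' [feas']]]] :=
    shifted_candidate control dissip N_ge1 feas.
  rewrite -xS -thetaS in feas'.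
  have := opt1 _ _ _ feas'.
  (* The dissipation constraint at k = 0 turns the cost drop of the shifted candidate, together with
     the change of storage, into a decrease of at least [rho]. *)
  have [xx0 th0 /(_ _ N_ge1)[xx1E _ +] _ _] := feas.
  rewrite xx1E xx0 th0 -xS -thetaS /lyapunov; lra.
have [th [xx [uu [[feas opt] _ _ ->]]]] := WP 0%N.
have Theta0 : param_set P (theta 0%N).
  by have [_ <- _ thP _] := feas; exact: thP.
have [th' [xx' [uu' [/opt]]]] := terminal_candidate control dissip Xfx0 Theta0.
by rewrite /lyapunov /rotated_terminal_cost /=; lra.
Qed.

Theorem corollary13 (R : realType) (n m p : nat) (P : empc R n m p)
    (kappaf : 'rV[R]_n -> 'rV[R]_m)
    (* system, constraints, cost, optimal steady state *)
    (f_maps : forall x u, state_set P x -> input_set P u ->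
       state_set P (dynamics P (x, u)))
    (f_cont : {within state_set P `*` input_set P, continuous (dynamics P)})
    (Z_sub : constraint_set P `<=` state_set P `*` input_set P)
    (Z_compact : compact (constraint_set P))
    (ell_cont : {within constraint_set P, continuous (stage_cost P)})
    (opt_steady : optimal_steady_states P = [set (xs P, us P)])
    (* rho is positive definite *)
    (rho_cont : continuous (rho P))
    (rho_0 : rho P 0 = 0)
    (rho_pos : forall z, z != 0 -> 0 < rho P z)
    (horizon_ge1 : (1 <= horizon P)%N)
    (* (A1) *)
    (Theta_compact : compact (param_set P))
    (* (A2) *)
    (lambda_cont :
       {within param_set P `*` state_set P, continuous (storage P)})
    (* (A3) *)
    (strictly_controlled_dissipative : forall theta x,
       param_set P theta -> state_set P x ->
       exists theta' u,
         [/\ param_set P theta', input_set P u, constraint_set P (x, u) &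
             storage P (theta', dynamics P (x, u)) - storage P (theta, x)
             <= stage_cost P (x, u) - stage_cost P (xs P, us P)
                - rho P (x - xs P)])
    (* (A4) *)
    (Xf_sub : terminal_set P `<=` state_set P)
    (Xf_compact : compact (terminal_set P))
    (xs_interior : (terminal_set P)° (xs P))
    (kappaf_maps : forall x, state_set P x -> input_set P (kappaf x))
    (kappaf_xs : kappaf (xs P) = us P)
    (Vf_cont : {within terminal_set P, continuous (terminal_cost P)})
    (terminal_control : forall x, terminal_set P x ->
       [/\ constraint_set P (x, kappaf x),
           terminal_set P (dynamics P (x, kappaf x)) &
           terminal_cost P (dynamics P (x, kappaf x)) - terminal_cost P x
           <= stage_cost P (xs P, us P) - stage_cost P (x, kappaf x)])
    (* (A5) *)
    (terminal_dissipative : forall x theta,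
       terminal_set P x -> param_set P theta ->
       exists2 theta', param_set P theta' &
         storage P (theta', dynamics P (x, kappaf x)) - storage P (theta, x)
         <= stage_cost P (x, kappaf x) - stage_cost P (xs P, us P)
            - rho P (x - xs P))
    (* (A6) *)
    (lambda_xs : forall theta, param_set P theta ->
       storage P (theta, xs P) = 0) :
  (forall eps : R, 0 < eps ->
     exists2 delta : R, 0 < delta &
       forall x theta, closed_loop P x theta ->
         feasible_set P (x 0%N, theta 0%N) ->
         eucl_norm (x 0%N - xs P) < delta ->
         forall t, eucl_norm (x t - xs P) < eps) /\
  (forall x theta, closed_loop P x theta ->
     feasible_set P (x 0%N, theta 0%N) ->
     x t @[t --> \oo] --> xs P).
Proof.
have rho_ge0 z : 0 <= rho P z.
  by have [->|/rho_pos/ltW//] := eqVneq z 0; rewrite rho_0.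
have rho_xs_pos y : y <> xs P -> 0 < rho P (y - xs P).
  by move=> /eqP yxs; apply: rho_pos; rewrite subr_eq0.
have Xf_xs : terminal_set P (xs P) by exact: interior_subset.
have rho_xs_cont : continuous (fun y : 'rV[R]_n => rho P (y - xs P)).
  move=> y; apply: (@continuous_comp _ _ _ (fun y : 'rV[R]_n => y - xs P)).
    by apply: continuousB => //; exact: cst_continuous.
  exact: rho_cont.
have lambda_cont_Xf :
    {within param_set P `*` terminal_set P, continuous (storage P)}.
  by apply: continuous_subspaceW lambda_cont => z [Tz /Xf_sub Xz].
have Vtilde_cont : {within param_set P `*` terminal_set P,
    continuous (rotated_terminal_cost P)}.
  apply/subspace_continuousP => -[theta y] [/= Ttheta Xfy].
  apply: cvgB; last exact: cvg_cst.
  apply: cvgD; last first.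
    by move/subspace_continuousP : lambda_cont_Xf; apply.
  (* Continuity of the terminal cost within the terminal set is pulled back along the second
     projection. *)
  move/subspace_continuousP : Vf_cont => /(_ _ Xfy) /= Vf_y A /Vf_y.
  rewrite /= !near_simpl !near_withinE => VA.
  near=> z; move=> [_ Xfz]; move: Xfz; near: z.
  exact: (@cvg_snd _ _ _ _ _ _ VA).
have Vtilde_xs theta : param_set P theta ->
    rotated_terminal_cost P (theta, xs P) = 0.
  by move=> /lambda_xs lam; rewrite /rotated_terminal_cost/= lam addr0 subrr.
have Vtilde_ge0 z : param_set P z.1 -> terminal_set P z.2 ->
    0 <= rotated_terminal_cost P z.
  move=> Tz Xz; apply: (compact_ge0_of_improvable
    (compact_setX Theta_compact Xf_compact) Vtilde_cont) => //.
  move=> {Tz Xz z} [theta y] [/= Ttheta Xfy] V_lt0.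
  have [_ Xfy' Vf_dec] := terminal_control _ Xfy.
  have [theta' Ttheta' lam_dec] := terminal_dissipative _ _ Xfy Ttheta.
  exists (theta', dynamics P (y, kappaf y)) => //.
  (* The rotated cost vanishes at [xs P], so a negative value forces [y] away from it, where [rho]
     makes the decrease strict. *)
  have y_xs : y <> xs P by move=> yxs; rewrite yxs Vtilde_xs// ltxx in V_lt0.
  have := rho_xs_pos _ y_xs.
  by move: Vf_dec lam_dec; rewrite /rotated_terminal_cost/=; lra.
(* The state set need not be compact, but every closed-loop state lies in the compact projection of
   the constraint set. *)
have loop_Z x theta t : closed_loop P x theta ->
    (fst @` constraint_set P) (x t).
  move=> /(_ t)[th [xx [uu [[[<- _ /(_ _ horizon_ge1)[_ Z0 _] _ _] _] _ _]]]].
  by exists (xx 0%N, uu 0%N).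
have Zx_compact : compact (fst @` constraint_set P).
  apply: continuous_compact => //; apply: continuous_subspaceT.
  by move=> ?; exact: cvg_fst.
have lyap x theta := @closed_loop_lyapunov _ _ _ _ P kappaf x theta
  terminal_control terminal_dissipative horizon_ge1 rho_ge0 Vtilde_ge0.
split=> [eps eps_gt0|x theta loop _].
  (* First [d] is chosen so that [rho] below [d] forces the [eps] bound; then [delta] so that the
     initial state is terminal and [W 0] is below [d]. Descent keeps [W], hence [rho], below [d]. *)
  have [d d_gt0 dP] := compact_small_value_nbhs Zx_compact rho_xs_cont
    rho_xs_pos (nbhs_eucl_norm_lt (xs P) eps_gt0).
  have xs_near : \forall y \near xs P, terminal_set P y /\
      forall theta, param_set P theta ->
        rotated_terminal_cost P (theta, y) < d.
    have := near_within_compact_small Theta_compact Xf_xs Vtilde_cont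
      Vtilde_xs d_gt0.
    by apply: filterS2 xs_interior => y Xfy; split=> //; auto.
  have [delta delta_gt0 deltaP] := nbhs_eucl_norm_ball xs_near.
  exists delta => // x theta loop [_ /= Theta0 _].
  move=> /deltaP[Xfx0 /(_ _ Theta0) V0].
  have [W [W_ge W_dec /(_ Xfx0) W0]] := lyap _ _ loop.
  have W_lt t : W t < d.
    elim: t => [|t]; first exact: le_lt_trans V0.
    apply: le_lt_trans; rewrite (le_trans (W_dec t))// gerBl.
    exact: rho_ge0.
  move=> t; apply: dP; first exact: loop_Z loop.
  exact: le_lt_trans (W_lt t).
have [W [W_ge W_dec _]] := lyap _ _ loop.
have rho_cvg0 : rho P (x t - xs P) @[t --> \oo] --> 0.
  apply: (@cvg0_of_telescoping _ W) => // t.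
  exact: le_trans (W_ge t).
(* Within the compact projection, small [rho] forces membership in the given neighbourhood [A], so
   convergence of [rho] to 0 gives convergence of the states. *)
move=> A /(compact_small_value_nbhs Zx_compact rho_xs_cont rho_xs_pos).
move=> [d d_gt0 dP]; move/cvgr_lt: rho_cvg0 => /(_ _ d_gt0).
by apply: filterS => t; apply: dP; exact: loop_Z loop.
Unshelve. all: by end_near. Qed.
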